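(* Let $A$ be a PBW algebra over a field $\mathbf{k}$ with a set of PBW-generators $x_1,\dots,x_n$, $n\ge2$, and suppose that the Gelfand-Kirillov dimension of $A$ is $m$ with $m<n$. Then $A$ has infinite global dimension, $\mathrm{gl\,dim}\,A=\infty$.
   Context: A PBW algebra with PBW-generators $x_1,\dots,x_n$ is a quadratic algebra $A=\mathbf{k}\langle x_1,\dots,x_n\rangle/(\Re)$, where $\Re$ is a finite set of homogeneous polynomials of degree two which forms a (noncommutative) Gröbner basis of the two-sided ideal $(\Re)$ with respect to the degree-lexicographic order on words with $x_1<\dots<x_n$ (i.e. the leading monomial of every nonzero element of $(\Re)$ contains the leading monomial of some element of $\Re$ as a subword). The generators $x_1,\dots,x_n$ have degree one and form a basis of $A_1$. *)

(* Defs.v *)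
From HB Require Import structures.
From mathcomp Require Import all_boot all_order all_algebra.
From mathcomp Require Import finmap all_classical all_reals all_analysis.
(* The notations of monalg clash with those of mathcomp-analysis. *)
From mathcomp Require Import -(notations) monalg.

Set Implicit Arguments.
Unset Strict Implicit.
Unset Printing Implicit Defensive.

Import Order.TTheory GRing.Theory Num.Theory.
Local Open Scope ring_scope.

Notation word n := (fmonom 'I_n).

(* k<x_1, ..., x_n>: the monoid algebra of the free monoid on 'I_n. *)
Notation free_alg k n := (malg (fmonom 'I_n) k).

Section FreeAlgebra.
Variables (k : fieldType) (n : nat).
Implicit Types (f : free_alg k n) (rels : seq (free_alg k n)) (u w : word n).

Definition free_var (i : 'I_n) : free_alg k n := mkmalgU (fmu i) 1.

Definition deglex_le u w : bool :=
  (size u < size w)%N ||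
  ((size u == size w) && ((u : seqlexi 'I_n) <= (w : seqlexi 'I_n))%O).

Definition leading_word f w : Prop :=
  w \in msupp f /\ forall u, u \in msupp f -> deglex_le u w.

Definition quadratic_form f : Prop :=
  forall w, w \in msupp f -> size w = 2%N.

Definition two_sided_ideal rels f : Prop :=
  exists (N : nat) (a r b : 'I_N -> free_alg k n),
    (forall i, r i \in rels) /\ f = \sum_i a i * r i * b i.

Definition groebner_basis rels : Prop :=
  forall f w, two_sided_ideal rels f -> leading_word f w ->
    exists r v, [/\ r \in rels, leading_word r v & infix v w].

End FreeAlgebra.

(* A is presented as k<x_1, ..., x_n> / (rels) through a surjective algebra
   morphism with kernel the two-sided ideal (rels). Since (rels) lives in
   degrees >= 2, it follows that the x i form a basis of A_1. *)
Definition PBW_algebra (k : fieldType) (n : nat) (A : algType k)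
    (x : 'I_n -> A) : Prop :=
  exists (rels : seq (free_alg k n)) (pi : {lrmorphism free_alg k n -> A}),
    [/\ forall r, r \in rels -> quadratic_form r,
        groebner_basis rels,
        forall i, pi (free_var k i) = x i,
        forall a, exists f, pi f = a
      & forall f, pi f = 0 <-> two_sided_ideal rels f].

Section GelfandKirillov.
Variables (k : fieldType).

Definition lin_indep (V : lmodType k) (I : finType) (v : I -> V)
    (S : {set I}) : Prop :=
  forall c : I -> k, \sum_(i in S) c i *: v i = 0 ->
    forall i, i \in S -> c i = 0.

(* V is not a vectType, so the dimension of the span of a finite family is
   taken to be the size of its largest linearly independent subfamilies. *)
Definition dim_span (V : lmodType k) (I : finType) (v : I -> V) : nat :=
  \max_(S : {set I} | `[< lin_indep v S >]) #|S|.

(* dim (k + W + W^2 + ... + W^N), where W is the span of v. *)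
Definition growth (A : algType k) (r : nat) (v : 'I_r -> A) (N : nat) : nat :=
  dim_span (fun w : {j : 'I_N.+1 & j.-tuple 'I_r} =>
              \prod_(i <- tagged w) v i).

(* The supremum over finite-dimensional W of
   limsup_N log_N dim (k + W + ... + W^N). *)
Definition GKdim (R : realType) (A : algType k) : \bar R :=
  ereal_sup [set g : \bar R | exists (r : nat) (v : 'I_r -> A),
    g = limn_esup (fun N => (ln ((growth v N)%:R : R) / ln (N%:R : R))%:E)].

End GelfandKirillov.

Section GlobalDimension.
Variable (A : pzRingType).

Definition surjective (X Y : Type) (f : X -> Y) : Prop :=
  forall y, exists x, f x = y.

Definition projective (P : lmodType A) : Prop :=
  forall (M N : lmodType A) (g : {linear M -> N}) (f : {linear P -> N}),
    surjective g -> exists h : {linear P -> M}, forall x, g (h x) = f x.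

(* pd M <= d: there is an exact sequence
   0 -> P_d -> ... -> P_1 -> P_0 -> M -> 0 with all P_i projective. *)
Definition proj_dim_le (M : lmodType A) (d : nat) : Prop :=
  exists (P : nat -> lmodType A) (eps : {linear P 0%N -> M})
         (del : forall i, {linear P i.+1 -> P i}),
    [/\ forall i, projective (P i),
        surjective eps,
        forall y, eps y = 0 <-> exists z, del 0%N z = y,
        forall i y, del i y = 0 <-> exists z, del i.+1 z = y
      & forall i, (d < i)%N -> forall y : P i, y = 0].

Definition lgldim_le (d : nat) : Prop :=
  forall M : lmodType A, proj_dim_le M d.

Definition lgldim_infinite : Prop := forall d, ~ lgldim_le d.

End GlobalDimension.

(* Right A-modules are the left modules over the converse ring A^c. *)
Definition gldim_infinite (A : pzRingType) : Prop :=
  lgldim_infinite A /\ lgldim_infinite A^c.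

(* Main.v *)
Require Import Defs.
From HB Require Import structures.
From mathcomp Require Import all_boot all_order all_algebra.
From mathcomp Require Import finmap all_classical all_reals all_analysis.
From mathcomp Require Import -(notations) monalg.

(** Call a pair of letters ab leading when it is the leading word of a
    quadratic relation of A, and normal otherwise; draw an arrow from a to b
    for every leading pair. A word all of whose adjacent pairs are leading is a
    path in this graph, and the theorem is a dichotomy on the lengths of paths.

    If paths have bounded length, the graph has no cycle, so the letters carry
    a height that drops along every arrow ([acyclic_height]). Words whose
    letters come in order of nondecreasing height then have only normal pairs,
    hence are linearly independent in A by the Groebner property
    ([normal_words_free]). There is one for each exponent vector, as for
    commutative monomials, so A grows at least like a polynomial ring in n
    variables ([growth_bound]) and its Gelfand-Kirillov dimension is at least n
    ([GKdim_ge]), which is excluded.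

    So there are paths of every length d, and these force Tor_d(k, k) to be
    nonzero. Write V for the span of the letters and R for the space of
    quadratic relations inside V (x) V. The part of Tor_d(k, k) of internal
    degree d is the space of Koszul tensors, the intersection of the subspaces
    V^i (x) R (x) V^(d-2-i) of the d-th tensor power of V. Two facts are needed.

    - Every path w of length d occurs with coefficient 1 in some Koszul tensor
      ([koszul_tensor_path]). The coefficients of a Koszul tensor are the
      functions on words that satisfy, at each normal pair, a linear rule
      expressing the value at a word through values at larger words; these are
      the rewriting rules of the quadratic dual algebra. The function can
      be prescribed freely on paths as soon as rules overlapping in three
      letters agree (the diamond lemma, [confluent_extension]). This
      confluence in degree three for the dual follows from the one for A: the
      reduction to zero of the S-polynomial of a path abc yields a Koszul
      tensor of degree three with leading word abc ([koszul3_lead]).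

    - If the trivial module k has a projective resolution P of length d, then
      all Koszul tensors of degree d + 1 vanish ([koszul_element_vanish]). A
      Koszul tensor u defines an element of P_i by lifting the Koszul complex
      to P. On the other side, splicing i extensions of k by k, each given by
      the coefficient of one letter, gives a map from P_i to k. The composite
      reads off the coefficient of u at the word formed by these letters, and
      for i = d + 1 it factors through 0.

    The second fact uses only the degree-zero and degree-one parts of A, and
    reversing words turns Koszul tensors of A into those of the converse ring;
    so left and right modules are treated by the same argument. *)

Set Implicit Arguments.
Unset Strict Implicit.
Unset Printing Implicit Defensive.

Import Order.TTheory GRing.Theory Num.Theory.
Local Open Scope ring_scope.

(** * Reduced bases of spaces of functions *)

Section ReducedBasis.
Variables (k : fieldType) (T : eqType) (s : seq T) (rk : T -> nat).

Definition subspace (S : (T -> k) -> Prop) :=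
  S (fun=> 0) /\
  forall c g h, S g -> S h -> S (fun z => c * g z + h z).

(** The rank decreases along the order on words, so a leading position is one of
    least rank. *)
Definition leads (g : T -> k) (w : T) :=
  g w != 0 /\ forall z, z \in s -> (rk z < rk w)%N -> g z = 0.

Definition lead_set (S : (T -> k) -> Prop) (w : T) : bool :=
  `[< exists2 g, S g & leads g w >].

Lemma eq_pred_fun (S : (T -> k) -> Prop) g h : g =1 h -> S g -> S h.
Proof. by move=> /funext ->. Qed.

Lemma subspace_sum (S : (T -> k) -> Prop) (I : eqType) (l : seq I)
    (P : pred I) (c : I -> k) (F : I -> T -> k) :
  subspace S -> (forall i, i \in l -> P i -> S (F i)) ->
  S (fun z => \sum_(i <- l | P i) c i * F i z).
Proof.
move=> [S0 SD]; elim: l => [|i l IH] SF.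
  by apply: eq_pred_fun S0 => z; rewrite big_nil.
have IHl : S (fun z => \sum_(i <- l | P i) c i * F i z).
  by apply: IH => j jl; apply: SF; rewrite in_cons jl orbT.
have [Pi|nPi] := boolP (P i).
  have := SD (c i) _ _ (SF i (mem_head _ _) Pi) IHl.
  by apply: eq_pred_fun => z; rewrite big_cons Pi.
by apply: eq_pred_fun IHl => z; rewrite big_cons (negPf nPi).
Qed.

Lemma min_rank_neq0 (g : T -> k) (z : T) : z \in s -> g z != 0 ->
  exists2 w, w \in s & leads g w.
Proof.
have [m] := ubnP (rk z); elim: m z => // m IH z zm zs gz.
have [/hasP[z' z's /andP[lt gz']]|/hasPn no] :=
    boolP (has (fun z' => (rk z' < rk z)%N && (g z' != 0)) s).
  by apply: (IH z') => //; apply: leq_trans lt _.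
exists z => //; split=> // z' z's lt; apply/eqP.
by have := no _ z's; rewrite lt /= negbK.
Qed.

Hypothesis rk_inj : {in s &, injective rk}.
Hypothesis s_uniq : uniq s.

Lemma sum_lead_delta (W : pred T) (a : T -> k) w : w \in s ->
  \sum_(w' <- s | W w') a w' * (w' == w)%:R = if W w then a w else 0.
Proof.
move=> ws; rewrite big_mkcond (bigD1_seq w) //= eqxx mulr1 big1_seq ?addr0 //.
by move=> i /andP[/negPf -> _]; rewrite mulr0 if_same.
Qed.

(** Gaussian elimination, run from the largest rank down: the basis vectors are
    indexed by the leading positions of [S], and an element of [S] is recovered
    from its values there because a difference that vanishes at all leading
    positions has no leading position of its own. *)
Lemma reduced_basis (S : (T -> k) -> Prop) : subspace S ->
  exists r : T -> T -> k,
    [/\ forall w, w \in s -> lead_set S w -> S (r w),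
        forall w z, w \in s -> lead_set S w -> z \in s ->
          (rk z < rk w)%N -> r w z = 0,
        forall w w', w \in s -> lead_set S w -> w' \in s -> lead_set S w' ->
          r w w' = (w == w')%:R
      & forall g z, S g -> z \in s ->
          g z = \sum_(w <- s | lead_set S w) g w * r w z].
Proof.
move=> Ssub; have [S0 SD] := Ssub.
pose ok w r := [/\ S r, forall z, z \in s -> (rk z < rk w)%N -> r z = 0 &
  forall w', w' \in s -> lead_set S w' -> r w' = (w == w')%:R].
pose bd := (\max_(w <- s) rk w)%N.
have rbd w : w \in s -> (rk w <= bd)%N by move=> ws; exact: leq_bigmax_seq.
have ex w : w \in s -> lead_set S w -> exists r, ok w r.
  have [m] := ubnP (bd - rk w)%N.
  elim: m w => // m IH w wm ws lw.
  have [g Sg [gw gl]] := asboolW lw.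
  have /boolp.choice [r rP] : forall w', exists r,
      w' \in s -> lead_set S w' -> (rk w < rk w')%N -> ok w' r.
    move=> w'; have [w's|] := boolP (w' \in s); last by exists g.
    have [lw'|] := boolP (lead_set S w'); last by exists g.
    have [lt|] := ltnP (rk w) (rk w'); last by exists g.
    have lt' : (bd - rk w' < m)%N.
      by rewrite -ltnS (leq_trans _ wm) // ltnS ltn_sub2l // (leq_trans lt) // rbd.
    by have [r rP] := IH w' lt' w's lw'; exists r.
  (* normalize g, then clear its values at leading positions of larger rank *)
  pose h z := (g w)^-1 * g z.
  have Sh : S h by apply: eq_pred_fun (SD (g w)^-1 _ _ Sg S0) => z; rewrite addr0.
  have hl z : z \in s -> (rk z < rk w)%N -> h z = 0.
    by move=> zs lt; rewrite /h (gl z) // mulr0.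
  pose Q w' := lead_set S w' && (rk w < rk w')%N.
  exists (fun z => -1 * (\sum_(w' <- s | Q w') h w' * r w' z) + h z); split.
  - apply: SD => //; apply: subspace_sum => // w' w's /andP[lw' lt].
    by have [] := rP w' w's lw' lt.
  - move=> z zs lt; rewrite hl // addr0 big1_seq ?mulr0 // => w'.
    move=> /andP[/andP[lw' lt'] w's].
    have [_ rz _] := rP w' w's lw' lt'.
    by rewrite rz ?mulr0 //; apply: ltn_trans lt lt'.
  - move=> w' w's lw'.
    have -> : \sum_(i <- s | Q i) h i * r i w' =
              \sum_(i <- s | Q i) h i * (i == w')%:R.
      rewrite big_seq_cond [RHS]big_seq_cond; apply: eq_bigr => i /and3P[iS li lt].
      by have [_ _ ->] := rP i iS li lt.
    rewrite sum_lead_delta // /Q lw' /=.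
    case: (ltngtP (rk w) (rk w')) => [lt|lt|eq].
    + by rewrite mulN1r addNr; case: eqP lt => // ->; rewrite ltnn.
    + by rewrite mulr0 add0r hl //; case: eqP lt => // ->; rewrite ltnn.
    + by rewrite (rk_inj ws w's eq) mulr0 add0r eqxx /h -(rk_inj ws w's eq) mulVf.
have /boolp.choice [r rP] : forall w, exists r, w \in s -> lead_set S w -> ok w r.
  move=> w; have [ws|] := boolP (w \in s); last by exists (fun=> 0).
  have [lw|] := boolP (lead_set S w); last by exists (fun=> 0).
  by have [r rP] := ex w ws lw; exists r.
exists r; split.
- by move=> w ws lw; have [] := rP w ws lw.
- by move=> w z ws lw; have [_ + _] := rP w ws lw; apply.
- by move=> w w' ws lw; have [_ _ +] := rP w ws lw; apply.
move=> g z Sg zs; apply/eqP; rewrite -subr_eq0; apply/negPn/negP => nz.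
pose d z := -1 * (\sum_(w <- s | lead_set S w) g w * r w z) + g z.
have Sd : S d.
  apply: SD => //; apply: subspace_sum => // w ws lw.
  by have [] := rP w ws lw.
have dz : d z != 0 by rewrite /d mulN1r addrC.
have [w ws ld] := min_rank_neq0 zs dz.
have lw : lead_set S w by apply/asboolP; exists d.
case: ld => /eqP[]; rewrite /d.
have -> : \sum_(i <- s | lead_set S i) g i * r i w =
          \sum_(i <- s | lead_set S i) g i * (i == w)%:R.
  rewrite big_seq_cond [RHS]big_seq_cond; apply: eq_bigr => i /andP[iS li].
  by have [_ _ ->] := rP i iS li.
by rewrite sum_lead_delta // lw mulN1r addNr.
Qed.

End ReducedBasis.

(** * Words and their order *)

Section Words.
Variable n : nat.
Implicit Types (p q s t z : seq 'I_n).

Fixpoint words (d : nat) : seq (seq 'I_n) :=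
  if d is d'.+1 then [seq i :: w | i <- enum 'I_n, w <- words d'] else [:: [::]].

Lemma mem_words d w : (w \in words d) = (size w == d).
Proof.
elim: d w => [|d IH] [|i w] //=.
  by apply/negbTE/allpairsP => -[[? ?] [_ _]].
rewrite eqSS -IH; apply/allpairsP/idP => [[[j u] /= [_ uw [_ ->]]] //|wd].
by exists (i, w); rewrite mem_enum.
Qed.

Lemma words_uniq d : uniq (words d).
Proof.
elim: d => //= d IH; apply: allpairs_uniq => //; first exact: enum_uniq.
by move=> [i w] [j u] _ _ /= [-> ->].
Qed.

Lemma big_words_cat (V : nmodType) d e (F : seq 'I_n -> V) :
  \sum_(w <- words (d + e)) F w =
  \sum_(u <- words d) \sum_(v <- words e) F (u ++ v).
Proof.
elim: d F => [|d IH] F; first by rewrite big_seq1.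
rewrite /= !big_allpairs_dep; apply: eq_bigr => i _.
by rewrite (IH (fun w => F (i :: w))).
Qed.

Lemma big_words1 (V : nmodType) (F : seq 'I_n -> V) :
  \sum_(w <- words 1) F w = \sum_i F [:: i].
Proof.
rewrite -[words 1]/[seq i :: w | i <- enum 'I_n, w <- words 0] big_allpairs_dep.
by rewrite big_enum; apply: eq_bigr => i _; rewrite big_seq1.
Qed.

(** The numeral of [w] in base [n], the digit [i] being replaced by [n - 1 - i]:
    among words of equal length, a lexicographically larger word has smaller
    rank. *)
Fixpoint rank (w : seq 'I_n) : nat :=
  if w is i :: w' then ((n - i.+1) * n ^ size w' + rank w')%N else 0%N.

Lemma rank_bound w : (rank w < n ^ size w)%N.
Proof.
elim: w => //= i w IH; rewrite expnS.
have n0 : (0 < n)%N by apply: leq_trans (ltn_ord i).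
apply: (@leq_trans ((n - i.+1) * n ^ size w + n ^ size w)).
  by rewrite ltn_add2l.
by rewrite -mulSnr leq_mul2r -subSn ?subSS ?leq_subr ?orbT.
Qed.

Lemma rank_cat s t : rank (s ++ t) = (rank s * n ^ size t + rank t)%N.
Proof.
elim: s => //= i s ->.
by rewrite size_cat expnD mulnA mulnDl addnA.
Qed.

Lemma rank_cons_lt i j s t : size s = size t ->
  (rank (i :: s) < rank (j :: t))%N =
  ((j < i)%N || (i == j) && (rank s < rank t)%N).
Proof.
move=> e; rewrite /= -e; set M := (n ^ size s)%N.
have bs : (rank s < M)%N := rank_bound s.
have bt : (rank t < M)%N by rewrite /M e rank_bound.
have lti := ltn_ord i; have ltj := ltn_ord j.
have step (a b : 'I_n) u v : (b < a)%N -> (u < M)%N ->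
    ((n - a.+1) * M + u < (n - b.+1) * M + v)%N.
  move=> lt ub; apply: (@leq_trans ((n - a.+1).+1 * M)).
    by rewrite mulSnr ltn_add2l.
  apply: leq_trans (leq_addr _ _); rewrite leq_mul2r; apply/orP; right.
  by rewrite ltn_sub2l // (leq_ltn_trans lt).
case: (ltngtP j i) => [lt|lt|/val_inj ->] /=.
- by rewrite step.
- rewrite ltnNge ltnW ?step //; case: eqP lt => // ->; by rewrite ltnn.
- by rewrite eqxx ltn_add2l.
Qed.

Lemma rank_inj s t : size s = size t -> rank s = rank t -> s = t.
Proof.
elim: s t => [|i s IH] [|j t] // [e] r.
have := rank_cons_lt i j e; have := rank_cons_lt j i (esym e).
rewrite r ltnn; case: (ltngtP i j) => // ij; have {}ij := val_inj ij.
subst j; move: r => /= /eqP; rewrite e eqn_add2l => /eqP r _ _.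
by rewrite (IH t).
Qed.

Lemma rank_inj_words d : {in words d &, injective rank}.
Proof.
by move=> s t; rewrite !mem_words => /eqP ss /eqP st; apply: rank_inj; rewrite ss.
Qed.

Lemma rank_context p q s t : size s = size t -> (rank s < rank t)%N ->
  (rank (p ++ s ++ q) < rank (p ++ t ++ q))%N.
Proof.
move=> e lt; rewrite !rank_cat !size_cat e ltn_add2l ltn_add2r ltn_pmul2r //.
rewrite expn_gt0; case: (posnP n) => //= n0.
by case: t lt {e} => // i; have := ltn_ord i; rewrite {2}n0.
Qed.

Lemma rank_lexi s t : size s = size t ->
  ((s : seqlexi 'I_n) <= (t : seqlexi 'I_n))%O = (rank t <= rank s)%N.
Proof.
elim: s t => [|i s IH] [|j t] // [e].
rewrite lexi_cons IH // [RHS]leqNgt rank_cons_lt // !leEord.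
case: (ltngtP i j) => [lt|lt|/val_inj ->] /=; rewrite ?ltnn ?eqxx ?andbT -?leqNgt //.
by case: eqP lt => // ->; rewrite ltnn.
Qed.

End Words.

(** * The diamond lemma for functionals *)

Section Confluence.
Variables (k T : Type) (rk : T -> nat) (rule : T -> ((T -> k) -> k) -> Prop).

(** The diamond lemma read dually. A rule at [v] asks that the value at [v] be
    computed from values of smaller rank; competing rules at [v] must agree on
    functions obeying all rules at points of smaller rank. The function is built
    by recursion on the rank, choosing one rule at each point; confluence then
    gives the others. *)
Lemma confluent_extension (N0 : T -> k) :
  (forall v L N N', rule v L ->
     (forall z, (rk z < rk v)%N -> N z = N' z) -> L N = L N') ->
  (forall v L L' N, rule v L -> rule v L' ->
     (forall z M, (rk z < rk v)%N -> rule z M -> N z = M N) -> L N = L' N) ->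
  exists N, (forall v L, rule v L -> N v = L N) /\
            (forall v, (forall L, ~ rule v L) -> N v = N0 v).
Proof.
move=> local confl.
pose step N v := if pselect (exists L, rule v L) is left e
                 then projT1 (boolp.cid e) N else N0 v.
have step_local N N' v : (forall z, (rk z < rk v)%N -> N z = N' z) ->
    step N v = step N' v.
  move=> eqN; rewrite /step; case: pselect => // e; case: boolp.cid => L /= rL.
  exact: local rL eqN.
(* the value at v is stable once the number of iterations exceeds its rank *)
pose F m := iter m step N0.
have stable m m' v : (rk v < m)%N -> (rk v < m')%N -> F m v = F m' v.
  elim: m m' v => // m IH [|m'] // v vm vm'; apply: step_local => z zv.
  by apply: IH; [apply: leq_trans zv _|apply: leq_trans zv _].
pose N v := F (rk v).+1 v.
have Nstep v : N v = step N v.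
  by apply: step_local => z zv; apply: stable.
exists N; split=> [v L|v nov]; last first.
  by rewrite Nstep /step; case: pselect => // -[L rL]; case: (nov L).
have [m] := ubnP (rk v); elim: m v L => // m IH v L vm rL.
rewrite Nstep /step; case: pselect => [e|[]]; last by exists L.
case: boolp.cid => L' /= rL'; apply: (confl v) => // z M zv rM.
by apply: IH => //; apply: leq_trans zv _.
Qed.

End Confluence.

(** * Quadratic relations and confluence in degree three *)

Section QuadraticGroebner.
Variables (k : fieldType) (n : nat) (A : algType k) (x : 'I_n -> A).
Implicit Types (g h N : seq 'I_n -> k) (p q w z : seq 'I_n).

Definition monom w : A := \prod_(i <- w) x i.

Definition is_relation d g := \sum_(w <- words n d) g w *: monom w = 0.

Definition leading_words d : pred (seq 'I_n) :=
  lead_set (words n d) (@rank n) (is_relation d).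

Local Notation W := (leading_words 2).

(** For words of length d, membership in the intersection of all
    V^i (x) R (x) V^(d-2-i); one function on all words treats all d at once. *)
Definition koszul_tensor g :=
  forall p q, is_relation 2 (fun z => g (p ++ z ++ q)).

Lemma is_relation_subspace d : subspace (is_relation d).
Proof.
split=> [|c g h Rg Rh]; rewrite /is_relation.
  by apply: big1 => w _; rewrite scale0r.
under eq_bigr do rewrite scalerDl -scalerA.
by rewrite big_split /= -scaler_sumr Rg scaler0 Rh addr0.
Qed.

Lemma eq_is_relation d g h : (forall z, size z = d -> g z = h z) ->
  is_relation d g -> is_relation d h.
Proof.
move=> e Rg; rewrite /is_relation -[RHS]Rg; apply: eq_big_seq => z.
rewrite mem_words => /eqP sz.
by rewrite e.
Qed.

(* r w is the element of the reduced basis of R with leading word w, that is w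
   minus its normal form; W restricts the sums to leading pairs. *)
Variable r : seq 'I_n -> seq 'I_n -> k.
Hypothesis r_rel : forall w, w \in words n 2 -> W w -> is_relation 2 (r w).
Hypothesis r_low : forall w z, w \in words n 2 -> W w -> z \in words n 2 ->
  (rank z < rank w)%N -> r w z = 0.
Hypothesis r_delta : forall w w', w \in words n 2 -> W w ->
  w' \in words n 2 -> W w' -> r w w' = (w == w')%:R.
Hypothesis r_expand : forall g z, is_relation 2 g -> z \in words n 2 ->
  g z = \sum_(w <- words n 2 | W w) g w * r w z.

Hypothesis groebner3 : forall g z, is_relation 3 g -> z \in words n 3 ->
  leads (words n 3) (@rank n) g z ->
  exists a b c, z = [:: a; b; c] /\ (W [:: a; b] || W [:: b; c]).

(** The rule at the pair [z] in the context [p], [q]. In the quadratic dual a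
    normal pair z rewrites to the leading pairs w with coefficients [r w z]; these
    w are larger than z. *)
Definition rewrite_pair (N : seq 'I_n -> k) p z q :=
  \sum_(w <- words n 2 | W w) r w z * N (p ++ w ++ q).

Lemma rewrite_leading N p z q : z \in words n 2 -> W z ->
  rewrite_pair N p z q = N (p ++ z ++ q).
Proof.
move=> z2 Wz; rewrite /rewrite_pair.
transitivity (\sum_(w <- words n 2 | W w) N (p ++ w ++ q) * (w == z)%:R).
  rewrite big_seq_cond [RHS]big_seq_cond; apply: eq_bigr => w /andP[w2 Ww].
  by rewrite r_delta // mulrC.
by rewrite (sum_lead_delta (words_uniq _ _) _ (fun w => N (p ++ w ++ q))) // Wz.
Qed.

Lemma eq_rewrite_sum (F G : seq 'I_n -> k) z : z \in words n 2 -> ~~ W z ->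
  (forall w, w \in words n 2 -> (rank w < rank z)%N -> F w = G w) ->
  \sum_(w <- words n 2 | W w) r w z * F w =
  \sum_(w <- words n 2 | W w) r w z * G w.
Proof.
move=> z2 nW eqF; rewrite big_seq_cond [RHS]big_seq_cond.
apply: eq_bigr => w /andP[w2 Ww].
case: (ltngtP (rank z) (rank w)) => [lt|lt|e]; last 1 first.
- by move: nW; rewrite (rank_inj_words z2 w2 e) Ww.
- by rewrite r_low // !mul0r.
- by rewrite eqF.
Qed.

Lemma eq_rewrite_pair N N' p z q : z \in words n 2 -> ~~ W z ->
  (forall w, (rank w < rank (p ++ z ++ q))%N -> size w = size (p ++ z ++ q) ->
    N w = N' w) ->
  rewrite_pair N p z q = rewrite_pair N' p z q.
Proof.
move=> z2 nW eqN; apply: eq_rewrite_sum => // w w2 lt.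
have sw : size w = size z by move: w2 z2; rewrite !mem_words => /eqP -> /eqP.
by apply: eqN; [exact: rank_context|rewrite !size_cat sw].
Qed.

(** An element of R is determined by its values at leading pairs, so being in R
    amounts to obeying the rules. *)
Lemma relation_rewrite g p q :
  (forall z, z \in words n 2 -> g (p ++ z ++ q) = rewrite_pair g p z q) <->
  is_relation 2 (fun z => g (p ++ z ++ q)).
Proof.
split=> [eg|Rg z z2]; last first.
  by rewrite (r_expand Rg z2); apply: eq_bigr => w _; rewrite mulrC.
have := subspace_sum (fun w => g (p ++ w ++ q)) (is_relation_subspace 2) r_rel.
apply: eq_is_relation => z sz; rewrite eg ?mem_words ?sz //.
by apply: eq_bigr => w _; rewrite mulrC.
Qed.

(** The products of a relation with a letter on either side, as functions on
    words of length three. *)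
Definition rel_left w c z := r w (take 2 z) * (drop 2 z == [:: c])%:R.
Definition rel_right a w z := r w (drop 1 z) * (take 1 z == [:: a])%:R.

Lemma monom_cat u v : monom (u ++ v) = monom u * monom v.
Proof. exact: big_cat. Qed.

Lemma rel_leftE w c z c' : size z = 2%N ->
  rel_left w c (z ++ [:: c']) = (c' == c)%:R * r w z.
Proof.
move=> sz; rewrite /rel_left take_size_cat // drop_size_cat //.
by rewrite mulrC eqseq_cons andbT.
Qed.

Lemma rel_rightE w a a' z : rel_right a w (a' :: z) = (a' == a)%:R * r w z.
Proof. by rewrite /rel_right /= drop0 take0 mulrC eqseq_cons andbT. Qed.

Definition left_rel g := forall c, is_relation 2 (fun z => g (z ++ [:: c])).
Definition right_rel g := forall a, is_relation 2 (fun z => g (a :: z)).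

Lemma relation_scale d c g : is_relation d g -> is_relation d (fun z => c * g z).
Proof.
move=> Rg; have [R0 RD] := is_relation_subspace d.
by apply: eq_pred_fun (RD c _ _ Rg R0) => z; rewrite addr0.
Qed.

Lemma is_relation_left g : left_rel g -> is_relation 3 g.
Proof.
move=> Rg; rewrite /is_relation (big_words_cat 2 1) exchange_big big_words1.
rewrite big1 // => c _.
under eq_bigr do rewrite monom_cat scalerAl.
by rewrite -mulr_suml Rg mul0r.
Qed.

Lemma is_relation_right g : right_rel g -> is_relation 3 g.
Proof.
move=> Rg; rewrite /is_relation (big_words_cat 1 2) big_words1 big1 // => a _.
under eq_bigr do rewrite monom_cat scalerAr.
by rewrite -mulr_sumr Rg mulr0.
Qed.

Lemma rel_left_relation w c : w \in words n 2 -> W w ->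
  left_rel (rel_left w c).
Proof.
move=> w2 Ww c'; apply: eq_is_relation (relation_scale (c' == c)%:R (r_rel w2 Ww)).
by move=> z sz; rewrite rel_leftE.
Qed.

Lemma rel_right_relation w a : w \in words n 2 -> W w ->
  right_rel (rel_right a w).
Proof.
move=> w2 Ww a'; apply: eq_is_relation (relation_scale (a' == a)%:R (r_rel w2 Ww)).
by move=> z sz; rewrite rel_rightE.
Qed.

Lemma word3_split z : size z = 3%N -> exists a b c, z = [:: a; b; c].
Proof. by case: z => [|a [|b [|c []]]] // _; exists a, b, c. Qed.

Lemma rel_left_low a b c z : W [:: a; b] -> size z = 3%N ->
  (rank z < rank [:: a; b; c])%N -> rel_left [:: a; b] c z = 0.
Proof.
move=> Wab /word3_split[a' [b' [c' ->]]].
rewrite -[[:: a'; b'; c']]/([:: a'; b'] ++ [:: c']) rel_leftE //.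
have [-> lt|] := eqVneq c' c; last by rewrite mul0r.
rewrite mul1r r_low ?mem_words // ltnNge; apply: contraL lt.
rewrite leq_eqVlt -leqNgt => /orP[/eqP/rank_inj -/(_ erefl) [-> ->] //|lt].
exact: ltnW (@rank_context _ [::] [:: c] [:: a; b] [:: a'; b'] _ lt).
Qed.

Lemma rel_right_low a b c z : W [:: b; c] -> size z = 3%N ->
  (rank z < rank [:: a; b; c])%N -> rel_right a [:: b; c] z = 0.
Proof.
move=> Wab /word3_split[a' [b' [c' ->]]]; rewrite rel_rightE //.
have [-> lt|] := eqVneq a' a; last by rewrite mul0r.
rewrite mul1r r_low ?mem_words // ltnNge; apply: contraL lt.
rewrite leq_eqVlt -leqNgt => /orP[/eqP/rank_inj -/(_ erefl) [-> ->] //|lt].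
exact: ltnW (@rank_context _ [:: a] [::] [:: b; c] [:: b'; c'] _ lt).
Qed.

Lemma rel_left_lead a b c : W [:: a; b] -> rel_left [:: a; b] c [:: a; b; c] = 1.
Proof.
move=> Wab; rewrite -[[:: a; b; c]]/([:: a; b] ++ [:: c]) rel_leftE // eqxx mul1r.
by rewrite r_delta ?mem_words ?eqxx.
Qed.

Lemma rel_right_lead a b c : W [:: b; c] -> rel_right a [:: b; c] [:: a; b; c] = 1.
Proof. by move=> Wbc; rewrite rel_rightE eqxx mul1r r_delta ?mem_words ?eqxx. Qed.

Lemma left_relD c g h :
  left_rel g -> left_rel h -> left_rel (fun z => c * g z + h z).
Proof. by move=> Rg Rh d; apply: (is_relation_subspace 2).2. Qed.

Lemma right_relD c g h :
  right_rel g -> right_rel h -> right_rel (fun z => c * g z + h z).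
Proof. by move=> Rg Rh d; apply: (is_relation_subspace 2).2. Qed.

Definition low_zero m g := forall z, size z = 3%N -> (rank z < m)%N -> g z = 0.

(** Division by the Groebner basis in degree three: a cubic relation is a sum of
    an element of R (x) V and one of V (x) R, neither of which involves larger
    words than the relation itself. Each step clears the largest word left. *)
Lemma standard_representation m g : is_relation 3 g -> low_zero m g ->
  exists p q : seq 'I_n -> k,
    [/\ left_rel p, right_rel q, low_zero m p, low_zero m q &
    forall z, size z = 3%N -> g z = p z + q z].
Proof.
have [e] := ubnP (n ^ 3 - m)%N.
elim: e m g => // e IH m g me Rg lowg.
have [big|small] := leqP (n ^ 3) m.
  exists (fun=> 0), (fun=> 0); split=> // [c|a|z sz].
  - by apply: (is_relation_subspace 2).1.
  - by apply: (is_relation_subspace 2).1.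
  - by rewrite addr0 lowg //; apply: leq_trans big; rewrite -sz rank_bound.
have me' : (n ^ 3 - m.+1 < e)%N.
  by rewrite -ltnS (leq_trans _ me) // ltnS ltn_sub2l.
have lowS h : low_zero m.+1 h -> low_zero m h.
  by move=> low z sz lt; apply: low; rewrite // ltnW.
have [[z [sz rz gz]]|no] :=
    pselect (exists z, [/\ size z = 3%N, rank z = m & g z != 0]); last first.
  have [|p [q [pL qR lp lq E]]] := IH _ _ me' Rg.
    move=> z sz; rewrite ltnS leq_eqVlt => /predU1P[rz|]; last exact: lowg.
    by apply/eqP/negPn/negP => gz; apply: no; exists z.
  by exists p, q; split=> //; apply: lowS.
have z3 : z \in words n 3 by rewrite mem_words sz.
have glead : leads (words n 3) (@rank n) g z.
  by split=> // z'; rewrite mem_words rz => /eqP; exact: lowg.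
have [a [b [c [zE]]]] := groebner3 Rg z3 glead.
have subtract h : h z = 1 -> is_relation 3 h -> low_zero m h ->
    low_zero m.+1 (fun t => - g z * h t + g t).
  move=> hz Rh lowh t st; rewrite ltnS leq_eqVlt => /predU1P[rt|lt].
    have -> : t = z by apply: rank_inj; rewrite ?sz ?rt.
    by rewrite hz mulr1 addNr.
  by rewrite (lowh t) // (lowg t) // mulr0 addr0.
move=> /orP[Wab|Wbc].
- pose h := rel_left [:: a; b] c.
  have hL : left_rel h by apply: rel_left_relation; rewrite ?mem_words.
  have hz : h z = 1 by rewrite zE /h rel_left_lead.
  have lowh : low_zero m h.
    by move=> t st; rewrite -rz zE => lt; rewrite /h rel_left_low.
  have Rh := is_relation_left hL.
  have [p [q [pL qR lp lq E]]] := IH _ _ me'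
    ((is_relation_subspace 3).2 (- g z) _ _ Rh Rg) (subtract h hz Rh lowh).
  exists (fun t => g z * h t + p t), q; split=> //.
  + exact: left_relD.
  + by move=> t st lt; rewrite (lowh t) // (lowS _ lp t) // mulr0 addr0.
  + exact: lowS.
  + by move=> t st; rewrite -addrA -E // mulNr addNKr.
- pose h := rel_right a [:: b; c].
  have hL : right_rel h by apply: rel_right_relation; rewrite ?mem_words.
  have hz : h z = 1 by rewrite zE /h rel_right_lead.
  have lowh : low_zero m h.
    by move=> t st; rewrite -rz zE => lt; rewrite /h rel_right_low.
  have Rh := is_relation_right hL.
  have [p [q [pL qR lp lq E]]] := IH _ _ me'
    ((is_relation_subspace 3).2 (- g z) _ _ Rh Rg) (subtract h hz Rh lowh).
  exists p, (fun t => g z * h t + q t); split=> //.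
  + exact: right_relD.
  + exact: lowS.
  + by move=> t st lt; rewrite (lowh t) // (lowS _ lq t) // mulr0 addr0.
  + by move=> t st; rewrite addrCA -E // mulNr addNKr.
Qed.

Definition koszul3 g := left_rel g /\ right_rel g.

Lemma koszul3_subspace : subspace koszul3.
Proof.
split=> [|c g h [gL gR] [hL hR]]; last first.
  by split; [exact: left_relD|exact: right_relD].
by split=> c; apply: (is_relation_subspace 2).1.
Qed.

(** If ab and bc are both leading, the S-polynomial of the two relations only
    involves words below abc. Dividing it yields two expressions of the same
    function, one in R (x) V and one in V (x) R, with leading word abc. *)
Lemma koszul3_lead a b c : W [:: a; b] -> W [:: b; c] ->
  lead_set (words n 3) (@rank n) koszul3 [:: a; b; c].
Proof.
move=> Wab Wbc; set z := [:: a; b; c].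
pose h1 := rel_left [:: a; b] c; pose h2 := rel_right a [:: b; c].
have h1L : left_rel h1 by apply: rel_left_relation; rewrite ?mem_words.
have h2R : right_rel h2 by apply: rel_right_relation; rewrite ?mem_words.
pose g t := -1 * h2 t + h1 t.
have Rg : is_relation 3 g.
  exact: (is_relation_subspace 3).2 (is_relation_right h2R) (is_relation_left h1L).
have lowg : low_zero (rank z).+1 g.
  move=> t st; rewrite ltnS leq_eqVlt => /predU1P[/rank_inj -> //|lt].
    by rewrite /g /h1 /h2 rel_left_lead // rel_right_lead // mulN1r addNr.
  by rewrite /g /h1 /h2 rel_left_low // rel_right_low // mulr0 addr0.
have [p [q [pL qR lp lq E]]] := standard_representation Rg lowg.
pose u t := -1 * p t + h1 t.
have uE t : size t = 3%N -> u t = 1 * q t + h2 t.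
  move=> st; have /eqP := E t st.
  by rewrite /u /g mul1r !mulN1r addrC subr_eq => /eqP ->; rewrite -addrA addKr.
apply/asboolP; exists u.
  split; first exact: left_relD.
  move=> d; apply: eq_is_relation (right_relD 1 qR h2R d).
  by move=> t st; rewrite uE //= st.
split=> [|t]; first by rewrite /u lp // mulr0 add0r /h1 rel_left_lead // oner_eq0.
rewrite mem_words => /eqP st lt.
by rewrite /u lp // ?mulr0 ?add0r; [rewrite /h1 rel_left_low|rewrite ltnW].
Qed.

(** Confluence of two overlapping rules. A Koszul tensor [u] of degree three can
    be chosen to agree with [N] on paths; then both agree on every word above
    abc, since the rules propagate values downwards. As [u] obeys all rules,
    both sides equal the value of [u] at abc. *)
Lemma overlap_confluent (N : seq 'I_n -> k) a b c :
  ~~ W [:: a; b] -> ~~ W [:: b; c] ->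
  (forall p z q, z \in words n 2 -> ~~ W z -> size (p ++ z ++ q) = 3%N ->
     (rank (p ++ z ++ q) < rank [:: a; b; c])%N ->
     N (p ++ z ++ q) = rewrite_pair N p z q) ->
  rewrite_pair N [::] [:: a; b] [:: c] = rewrite_pair N [:: a] [:: b; c] [::].
Proof.
move=> nWab nWbc compat.
have [r3 [r3K _ r3d _]] :=
  reduced_basis (@rank_inj_words n 3) (words_uniq n 3) koszul3_subspace.
set K := lead_set _ _ _ in r3K r3d.
pose u t := \sum_(w <- words n 3 | K w) N w * r3 w t.
have [uL uR] : koszul3 u by apply: subspace_sum => //; exact: koszul3_subspace.
have uK z : z \in words n 3 -> K z -> u z = N z.
  move=> z3 Kz; rewrite /u.
  transitivity (\sum_(w <- words n 3 | K w) N w * (w == z)%:R).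
    rewrite big_seq_cond [RHS]big_seq_cond; apply: eq_bigr => w /andP[w3 Kw].
    by rewrite r3d.
  by rewrite sum_lead_delta ?words_uniq // Kz.
have urew p z q : z \in words n 2 -> size (p ++ z ++ q) = 3%N ->
    u (p ++ z ++ q) = rewrite_pair u p z q.
  move=> z2 sz; have sz2 : size z = 2%N by apply/eqP; rewrite -mem_words.
  have : (size p + size q)%N = 1%N.
    move: sz; rewrite !size_cat sz2 addnCA => /eqP.
    by rewrite -[3%N]/(2 + 1)%N eqn_add2l => /eqP.
  case: p {sz} => [|d [|? p]]; case: q => [|d' [|? q]] //= _.
    exact: (relation_rewrite u [::] [:: d']).2 (uL d') z z2.
  apply: ((relation_rewrite u [:: d] [::]).2 _ z z2).
  by apply: eq_is_relation (uR d) => t _; rewrite cats0.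
have agree z : size z = 3%N -> (rank z < rank [:: a; b; c])%N -> u z = N z.
  have [m] := ubnP (rank z); elim: m z => // m IH z zm sz lt.
  have [d [e [f zE]]] := word3_split sz.
  have [Wde|nWde] := boolP (W [:: d; e]); last first.
    have E : z = [::] ++ [:: d; e] ++ [:: f] by [].
    rewrite E in zm sz lt *.
    rewrite compat ?urew ?mem_words //.
    apply: eq_rewrite_pair; rewrite ?mem_words //.
    move=> w wlt sw; apply: IH; last exact: ltn_trans wlt lt.
      exact: leq_trans wlt _.
    by rewrite sw.
  have [Wef|nWef] := boolP (W [:: e; f]); last first.
    have E : z = [:: d] ++ [:: e; f] ++ [::] by [].
    rewrite E in zm sz lt *.
    rewrite compat ?urew ?mem_words //.
    apply: eq_rewrite_pair; rewrite ?mem_words //.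
    move=> w wlt sw; apply: IH; last exact: ltn_trans wlt lt.
      exact: leq_trans wlt _.
    by rewrite sw.
  by apply: uK; rewrite ?mem_words ?sz // zE; apply: koszul3_lead.
transitivity (u [:: a; b; c]).
  rewrite -[[:: a; b; c]]/([::] ++ [:: a; b] ++ [:: c]) urew ?mem_words //.
  by apply: eq_rewrite_pair; rewrite ?mem_words // => w lt sw; rewrite agree.
rewrite -[[:: a; b; c]]/([:: a] ++ [:: b; c] ++ [::]) urew ?mem_words //.
by apply: eq_rewrite_pair; rewrite ?mem_words // => w lt sw; rewrite agree.
Qed.

(** Rules at disjoint pairs commute, and rules sharing one letter are handled in
    degree three. *)
Lemma rewrite_confluent N p z q p' z' q' :
  z \in words n 2 -> z' \in words n 2 -> ~~ W z -> ~~ W z' ->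
  p ++ z ++ q = p' ++ z' ++ q' ->
  (forall s t u, t \in words n 2 -> ~~ W t ->
     (rank (s ++ t ++ u) < rank (p ++ z ++ q))%N ->
     N (s ++ t ++ u) = rewrite_pair N s t u) ->
  rewrite_pair N p z q = rewrite_pair N p' z' q'.
Proof.
wlog le : p z q p' z' q' / (size p <= size p')%N => [H|] z2 z'2 nW nW' E compat.
  have [le|/ltnW le] := leqP (size p) (size p'); first exact: H.
  by apply/esym/H => //; rewrite -E.
have [m p'E] : exists m, p' = p ++ m.
  exists (drop (size p) p'); rewrite -{1}(cat_take_drop (size p) p').
  congr (_ ++ _); have := congr1 (take (size p)) E.
  by rewrite take_size_cat // takel_cat.
subst p'; move: E; rewrite -catA => /eqP; rewrite eqseq_cat // eqxx /= => /eqP E.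
have [a [b zE]] : exists a b, z = [:: a; b].
  by move: z2; rewrite mem_words; case: (z) => [|a [|b []]] // _; exists a, b.
have [b' [c z'E]] : exists b' c, z' = [:: b'; c].
  by move: z'2; rewrite mem_words; case: (z') => [|b' [|c []]] // _; exists b', c.
case: m le E => [|d [|e m]] le.
- by rewrite zE z'E => -[-> -> ->]; rewrite cats0.
- rewrite zE z'E => -[ad bb' qE]; subst d b' q z z'.
  pose N' t := N (p ++ t ++ q').
  have key : rewrite_pair N' [::] [:: a; b] [:: c] =
             rewrite_pair N' [:: a] [:: b; c] [::].
    apply: overlap_confluent => // s t u t2 nWt st lt.
    have := compat (p ++ s) t (u ++ q') t2 nWt.
    rewrite /N' -!catA => -> //.
      by rewrite /rewrite_pair; apply: eq_bigr => w _; rewrite -!catA.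
    have := @rank_context _ p q' (s ++ t ++ u) [:: a; b; c] st lt.
    by rewrite -!catA.
  transitivity (rewrite_pair N' [::] [:: a; b] [:: c]).
    by apply: eq_bigr => w _; rewrite /N' -!catA.
  by rewrite key; apply: eq_bigr => w _; rewrite /N' cats0 -!catA.
- rewrite zE => -[ad be qE]; subst d e q z.
  transitivity (\sum_(w <- words n 2 | W w) r w [:: a; b] *
    \sum_(w' <- words n 2 | W w') r w' z' * N (p ++ w ++ m ++ w' ++ q')).
    apply: eq_rewrite_sum => // w w2 lt.
    have := compat (p ++ w ++ m) z' q' z'2 nW'; rewrite -!catA => -> //.
      by apply: eq_bigr => w' _; rewrite -!catA.
    apply: rank_context => //.
    by move: w2 z2; rewrite !mem_words => /eqP -> /eqP.
  under eq_bigr do rewrite mulr_sumr; rewrite exchange_big /=.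
  under eq_bigr do under eq_bigr do rewrite mulrCA.
  under eq_bigr do rewrite -mulr_sumr.
  apply: eq_rewrite_sum => // w w2 lt.
  have := compat p [:: a; b] (m ++ w ++ q') z2 nW; rewrite -!catA => -> //.
  have := @rank_context _ (p ++ [:: a, b & m]) q' w z'; rewrite -!catA; apply=> //.
  by move: w2 z'2; rewrite !mem_words => /eqP -> /eqP.
Qed.

Lemma koszul_tensor_extension (N0 : seq 'I_n -> k) :
  exists N, koszul_tensor N /\
    forall v, (forall p z q, v = p ++ z ++ q -> size z = 2%N -> W z) -> N v = N0 v.
Proof.
pose rule v L := exists p z q, [/\ v = p ++ z ++ q, z \in words n 2, ~~ W z &
  L = fun N => rewrite_pair N p z q].
have [|v L L' N [p [z [q [-> z2 nW ->]]]] [p' [z' [q' [E z'2 nW' ->]]]] compat|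
  N [Nrule Nirr]] := @confluent_extension _ _ (@rank n) rule N0.
- move=> v L N N' [p [z [q [-> z2 nW ->]]]] eqN.
  by apply: eq_rewrite_pair => // w lt _; exact: eqN.
- apply: rewrite_confluent => // s t u t2 nWt lt.
  by apply: (compat _ (fun N => rewrite_pair N s t u)) => //; exists s, t, u.
exists N; split=> [p q|v vW].
  apply/relation_rewrite => z z2; have [Wz|nW] := boolP (W z).
    by rewrite rewrite_leading.
  by apply: (Nrule _ (fun N => rewrite_pair N p z q)); exists p, z, q.
apply: Nirr => L [p [z [q [vE z2 /negP[]]]]]; apply: (vW p z q vE).
by apply/eqP; rewrite -mem_words.
Qed.

End QuadraticGroebner.

(** * Koszul tensors with a prescribed path *)

Section KoszulTensors.
Variables (k : fieldType) (n : nat) (A : algType k) (x : 'I_n -> A).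

Definition leading_pair : rel 'I_n := fun a b => leading_words x 2 [:: a; b].

Lemma sorted_pair (e : rel 'I_n) (w p q : seq 'I_n) a b :
  sorted e w -> w = p ++ [:: a; b] ++ q -> e a b.
Proof.
by move=> + wE; rewrite {}wE => /cat_sorted2[_ /cat_sorted2[/= /andP[]]].
Qed.

Lemma koszul_tensor_path w :
  (forall g z, is_relation x 3 g -> z \in words n 3 ->
    leads (words n 3) (@rank n) g z ->
    exists a b c, z = [:: a; b; c] /\ (leading_pair a b || leading_pair b c)) ->
  sorted leading_pair w -> exists N, koszul_tensor x N /\ N w = 1.
Proof.
move=> groebner3 w_path.
have [r [r1 r2 r3 r4]] := reduced_basis (@rank_inj_words n 2) (words_uniq n 2)
  (is_relation_subspace x 2).
(* no rule applies to a path, so its value can be prescribed to be 1 *)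
have [N [KN N1]] := koszul_tensor_extension r1 r2 r3 r4 groebner3 (fun=> 1).
exists N; split=> //; apply: N1 => p [|a [|b []]] // q wE _.
exact: sorted_pair w_path wE.
Qed.

End KoszulTensors.

(** * Extensions of the trivial module *)

(** What the homological argument needs of a graded algebra: scalars and
    generators, the degree-zero coefficient [mk_aug] and, for each generator,
    its coefficient [mk_der] in the degree-one part, which is a derivation over
    [mk_aug]. Unlike an algebra structure, these data pass to the converse
    ring without change. *)
Record marked_ring (k : fieldType) (n : nat) (B : pzRingType) := MarkedRing {
  mk_scal : k -> B;
  mk_gen : 'I_n -> B;
  mk_aug : B -> k;
  mk_der : 'I_n -> B -> k;
  mk_scalD : {morph mk_scal : a b / a + b};
  mk_scalM : {morph mk_scal : a b / a * b};
  mk_scal_gen : forall c i, mk_scal c * mk_gen i = mk_gen i * mk_scal c;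
  mk_augD : {morph mk_aug : a b / a + b};
  mk_augM : {morph mk_aug : a b / a * b};
  mk_aug1 : mk_aug 1 = 1;
  mk_aug_scal : forall c, mk_aug (mk_scal c) = c;
  mk_aug_gen : forall i, mk_aug (mk_gen i) = 0;
  mk_derD : forall l, {morph mk_der l : a b / a + b};
  mk_derM : forall l a b,
    mk_der l (a * b) = mk_aug a * mk_der l b + mk_der l a * mk_aug b;
  mk_der_gen : forall l i, mk_der l (mk_gen i) = (l == i)%:R
}.

Section TrivialModules.
Variables (k : fieldType) (n : nat) (B : pzRingType) (G : marked_ring k n B).

Definition trivial_module of marked_ring k n B : Type := k.

HB.instance Definition _ := GRing.Zmodule.copy (trivial_module G) k.

Definition trivial_scale (b : B) (v : trivial_module G) : trivial_module G :=
  mk_aug G b * v.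

Fact trivial_scaleA a b v :
  trivial_scale a (trivial_scale b v) = trivial_scale (a * b) v.
Proof. by rewrite /trivial_scale mk_augM mulrA. Qed.

Fact trivial_scale1 : left_id 1 trivial_scale.
Proof. by move=> v; rewrite /trivial_scale mk_aug1 mul1r. Qed.

Fact trivial_scaleDr : right_distributive trivial_scale +%R.
Proof. by move=> b u v; exact: mulrDr. Qed.

Fact trivial_scaleDl v : {morph trivial_scale^~ v : a b / a + b}.
Proof. by move=> a b; rewrite /trivial_scale mk_augD; exact: mulrDl. Qed.

HB.instance Definition _ := GRing.Zmodule_isLmodule.Build B (trivial_module G)
  trivial_scaleA trivial_scale1 trivial_scaleDr trivial_scaleDl.

Lemma trivial_scaleE b (v : trivial_module G) : b *: v = mk_aug G b * v :> k.
Proof. by []. Qed.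

Variable l : 'I_n.

(** The extension of the trivial module by itself whose class in Ext^1 is the
    functional taking the coefficient of the generator [l]. *)
Definition extension_module of marked_ring k n B & 'I_n : Type := (k * k)%type.

HB.instance Definition _ := GRing.Zmodule.copy (extension_module G l) (k * k)%type.

Definition extension_scale (b : B) (v : extension_module G l) :
    extension_module G l :=
  (mk_aug G b * v.1, mk_aug G b * v.2 + mk_der G l b * v.1).

Fact extension_scaleA a b v :
  extension_scale a (extension_scale b v) = extension_scale (a * b) v.
Proof.
rewrite /extension_scale /= mk_augM mk_derM mulrA; congr (_, _).
by rewrite mulrDr mulrDl !mulrA addrA.
Qed.

Fact mk_der1 : mk_der G l 1 = 0.
Proof.
have := mk_derM G l 1 1; rewrite !mulr1 mk_aug1 mul1r mulr1 => /eqP.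
by rewrite -subr_eq subrr eq_sym => /eqP.
Qed.

Fact extension_scale1 : left_id 1 extension_scale.
Proof.
by case=> u v; rewrite /extension_scale /= mk_aug1 mk_der1 !mul1r mul0r addr0.
Qed.

Fact extension_scaleDr : right_distributive extension_scale +%R.
Proof.
move=> b [u1 u2] [v1 v2]; rewrite /extension_scale /=.
by congr (_, _); rewrite ?mulrDr // addrACA.
Qed.

Fact extension_scaleDl v : {morph extension_scale^~ v : a b / a + b}.
Proof.
case: v => u v a b; rewrite /extension_scale /= mk_augD mk_derD.
by congr (_, _); rewrite /= ?mulrDl // addrACA.
Qed.

HB.instance Definition _ := GRing.Zmodule_isLmodule.Build B
  (extension_module G l) extension_scaleA extension_scale1
  extension_scaleDr extension_scaleDl.

Definition extension_proj (v : extension_module G l) : trivial_module G := v.1.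

Fact extension_proj_linear : linear extension_proj.
Proof. by []. Qed.

HB.instance Definition _ := GRing.isLinear.Build B (extension_module G l)
  (trivial_module G) _ extension_proj extension_proj_linear.

(** Yoneda product with the class of the extension: lift [t] through the
    extension along the projective module [P] and restrict along [d], where the
    lift falls into the submodule. The generator [l] is the only one that moves the
    quotient into the submodule, whence the last formula. *)
Lemma connecting_map (P Q : lmodType B) (d : {linear Q -> P})
    (t : {linear P -> trivial_module G}) :
  projective P -> (forall y, t (d y) = 0) ->
  exists T : {linear Q -> trivial_module G},
    (forall y, d y = 0 -> T y = 0) /\
    forall y (z : 'I_n -> P), d y = \sum_j mk_gen G j *: z j -> T y = t (z l).
Proof.
move=> projP td0.
have surj : surjective extension_proj by move=> v; exists (v, 0).
have [f fE] := projP _ _ extension_proj t surj.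
pose T y : trivial_module G := (f (d y)).2.
have Tlin : linear T.
  move=> b u v; rewrite /T !linearP /=.
  have /= f0 : (f (d u)).1 = 0 by have := fE (d u); rewrite td0.
  by rewrite f0 mulr0 addr0.
pose T' : {linear Q -> trivial_module G} :=
  HB.pack T (GRing.isLinear.Build B Q (trivial_module G) _ T Tlin).
exists T'; split=> [y dy|y z dy]; first by rewrite /= /T dy linear0.
rewrite /= /T dy linear_sum /=.
have snd_sum (I : finType) (F : I -> extension_module G l) :
    (\sum_i F i).2 = \sum_i (F i).2 by exact: (big_morph snd).
rewrite snd_sum (bigD1 l) //= big1 ?addr0 => [|j jl]; rewrite linearZ /=.
  by rewrite mk_aug_gen mul0r add0r mk_der_gen eqxx mul1r; exact: fE.
by rewrite mk_aug_gen mul0r add0r mk_der_gen eq_sym (negPf jl) mul0r.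
Qed.

End TrivialModules.

(** * Koszul tensors in projective resolutions *)

Section KoszulResolution.
Variables (k : fieldType) (n : nat) (B : pzRingType) (G : marked_ring k n B).

Local Notation iota := (mk_scal G).
Local Notation X := (mk_gen G).
Implicit Types (u : seq 'I_n -> k).

(** Koszul tensors again, with scalars acting through the ring so that the
    notion makes sense over the converse ring. *)
Definition koszul_element u := forall p q,
  \sum_i \sum_j iota (u (p ++ [:: i; j] ++ q)) * (X i * X j) = 0.

Definition tail_slice u j : seq 'I_n -> k := fun w => u (j :: w).

Lemma koszul_element_tail u j : koszul_element u -> koszul_element (tail_slice u j).
Proof. by move=> Ku p q; exact: (Ku (j :: p) q). Qed.

Lemma mk_scal0 : iota 0 = 0.
Proof. by apply: (addIr (iota 0)); rewrite -mk_scalD !add0r. Qed.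

Lemma koszul_element_subspace : subspace koszul_element.
Proof.
split=> [|c g h Kg Kh] p q.
  by rewrite big1 // => i _; rewrite big1 // => j _; rewrite mk_scal0 mul0r.
under eq_bigr => i _.
  under eq_bigr => j _ do rewrite mk_scalD mk_scalM mulrDl -mulrA.
  rewrite big_split -mulr_sumr; over.
by rewrite big_split -mulr_sumr /= Kg Kh mulr0 addr0.
Qed.

(** A linear map from tensors of degree [i] to [P], given by the images of
    words. *)
Definition combination (P : lmodType B) (y : seq 'I_n -> P) i u : P :=
  \sum_(w <- words n i) iota (u w) *: y w.

Lemma combination_sum (P : lmodType B) (y : seq 'I_n -> P) i
    (s : seq (seq 'I_n)) (S : pred (seq 'I_n)) (c : seq 'I_n -> k)
    (F : seq 'I_n -> seq 'I_n -> k) :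
  combination y i (fun v => \sum_(w <- s | S w) c w * F w v) =
  \sum_(w <- s | S w) iota (c w) *: combination y i (F w).
Proof.
rewrite /combination; under [RHS]eq_bigr do rewrite scaler_sumr.
rewrite exchange_big /=; apply: eq_bigr => v _.
under [RHS]eq_bigr do rewrite scalerA -mk_scalM.
rewrite -scaler_suml; congr (_ *: _).
exact: (big_morph iota (mk_scalD G) mk_scal0).
Qed.

Lemma combination_linear (P Q : lmodType B) (f : {linear P -> Q}) y i u :
  f (combination y i u) = combination (f \o y) i u.
Proof. by rewrite linear_sum; apply: eq_bigr => w _; rewrite linearZ. Qed.

(** By induction on [i], the Koszul complex maps to the resolution: the vectors
    [y] define its component in degree [i], and the boundary of the image of a
    tensor is given by splitting off its first letter. The next component exists
    since the boundary so prescribed is a cycle, by the relations; a reduced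
    basis of the Koszul tensors makes the choice of preimages linear. At the
    same time every word [w] of length [i] gives a map from [P i] to the trivial
    module, extended one letter at a time by [connecting_map], and the composite
    is the coefficient at [w]. *)
Theorem koszul_element_vanish d : proj_dim_le (trivial_module G) d ->
  forall u w, koszul_element u -> size w = d.+1 -> u w = 0.
Proof.
move=> [P [ep [del [projP surj_ep exact0 exactS zeroP]]]].
(* cycles, with the augmentation playing the role of the boundary in degree 0 *)
pose cyc i : P i -> Prop := match i return P i -> Prop with
  | 0 => fun y => ep y = 0 | j.+1 => fun y => del j y = 0 end.
have cycP i y : cyc i y <-> exists z, del i z = y by case: i y.
suff main i : exists y : seq 'I_n -> P i,
    (forall u, koszul_element u ->
       cyc i (\sum_j X j *: combination y i (tail_slice u j))) /\
    forall w, size w = i -> exists t : {linear P i -> trivial_module G},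
      (forall z, t (del i z) = 0) /\
      forall u, koszul_element u -> t (combination y i u) = u w.
  move=> u w Ku sw; have [y [_ /(_ w sw) [t [_ tE]]]] := main d.+1.
  by rewrite -(tE u Ku) (zeroP _ _ (combination _ _ _)) // linear0.
elim: i => [|i [y [ycyc yt]]].
  have [p0 ep0] := surj_ep (1 : k).
  exists (fun=> p0); split=> [u Ku|w sw].
    rewrite /= linear_sum big1 // => j _; rewrite linearZ.
    by rewrite /= trivial_scaleE mk_aug_gen mul0r.
  exists ep; split=> [z|u Ku]; first by apply/exact0; exists z.
  rewrite (size0nil sw) /combination big_seq1 linearZ ep0.
  by rewrite /= trivial_scaleE mk_aug_scal mulr1.
set K := lead_set (words n i.+1) (@rank n) koszul_element.
have [r [rK _ _ rE]] := reduced_basis (@rank_inj_words n i.+1)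
  (words_uniq n i.+1) koszul_element_subspace.
have /boolp.choice [z zE] : forall w, exists z, w \in words n i.+1 -> K w ->
    del i z = \sum_j X j *: combination y i (tail_slice (r w) j).
  move=> w; have [ws|] := boolP (w \in words n i.+1); last by exists 0.
  have [Kw|] := boolP (K w); last by exists 0.
  by have /cycP[z zE] := ycyc _ (rK w ws Kw); exists z.
pose y' w := if K w then z w else 0.
have delE u : koszul_element u -> del i (combination y' i.+1 u) =
    \sum_j X j *: combination y i (tail_slice u j).
  move=> Ku.
  transitivity (\sum_(w <- words n i.+1 | K w) iota (u w) *:
                  \sum_j X j *: combination y i (tail_slice (r w) j)).
    rewrite combination_linear [RHS]big_mkcond; apply: eq_big_seq => w ws /=.
    rewrite /y'; case: ifP => Kw; last by rewrite linear0 scaler0.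
    by rewrite zE.
  under eq_bigr do rewrite scaler_sumr; rewrite exchange_big /=.
  apply: eq_bigr => j _.
  under eq_bigr do rewrite scalerA mk_scal_gen -scalerA.
  rewrite -scaler_sumr -(combination_sum y i (words n i.+1) K u
    (fun w => tail_slice (r w) j)); congr (_ *: _).
  apply: eq_big_seq => v; rewrite mem_words => /eqP sv; congr (iota _ *: _).
  by rewrite [RHS](rE u (j :: v) Ku) // mem_words /= sv.
exists y'; split=> [u Ku|[|l w] // [sw]].
  rewrite /cyc linear_sum /=.
  under eq_bigr => j _.
    rewrite linearZ /= delE; last exact: koszul_element_tail.
    rewrite scaler_sumr.
    under eq_bigr => m _.
      rewrite /combination !scaler_sumr.
      under eq_bigr => v _ do
        rewrite [X m *: _]scalerA -mk_scal_gen -scalerA scalerA -mk_scal_gen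
          -scalerA scalerA scalerA.
      over.
    rewrite exchange_big /=.
    under eq_bigr do rewrite -scaler_suml.
    over.
  rewrite exchange_big big1 // => v _; rewrite -scaler_suml /=.
  rewrite (_ : \sum_j _ = 0) ?scale0r //.
  have := Ku [::] v; rewrite /tail_slice /=; apply: etrans.
  apply: eq_bigr => j _; apply: eq_bigr => m _.
  by rewrite -mulrA.
have [t [tdel tE]] := yt w sw.
have [T [Tdel TE]] := connecting_map l (projP i) tdel.
exists T; split=> [v|u Ku]; first by apply: Tdel; apply/exactS; exists v.
by rewrite (TE _ _ (delE u Ku)) tE //; exact: koszul_element_tail.
Qed.

End KoszulResolution.

(** * Coefficients in the free algebra *)

Section FreeAlgebra.
Variables (k : fieldType) (n : nat).
Implicit Types (f g : free_alg k n) (u w : word n).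

Definition coef f u : k := mcoeff u f.
Definition mono (s : seq 'I_n) : free_alg k n := mkmalgU (FMonom s) 1.

Lemma coef_sum (I : Type) (s : seq I) (P : pred I) (F : I -> free_alg k n) u :
  coef (\sum_(i <- s | P i) F i) u = \sum_(i <- s | P i) coef (F i) u.
Proof. exact: (raddf_sum (mcoeff u)). Qed.

Lemma coefD f g u : coef (f + g) u = coef f u + coef g u.
Proof. exact: mcoeffD. Qed.

Lemma coefZ c f u : coef (c *: f) u = c * coef f u.
Proof. exact: mcoeffZ. Qed.

Lemma coef_mono s u : coef (mono s) u = (s == u)%:R.
Proof. by rewrite /coef /mono mcoeffU1 fmP. Qed.

Lemma mem_msupp f u : (u \in msupp f) = (coef f u != 0).
Proof. by rewrite mcoeff_neq0. Qed.

Lemma free_expand f : f = \sum_(u <- msupp f) coef f u *: mono u.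
Proof.
rewrite {1}[f]monalgE; apply: eq_bigr => u _.
by apply/malgP => v; rewrite mcoeffZ !mcoeffU fmK mulr_natr.
Qed.

Lemma mono_cat s t : mono (s ++ t) = mono s * mono t.
Proof.
rewrite /mono malgM_def fgmulUU mulr1; congr mkmalgU.
by apply/eqP; rewrite fmP fmM.
Qed.


Lemma mono0 : mono [::] = 1.
Proof. by rewrite /mono -fmoneE. Qed.

Lemma mono1 i : mono [:: i] = free_var k i.
Proof. by rewrite /mono -fmuE. Qed.

Lemma coefM f g u : coef (f * g) u =
  \sum_(s <- msupp f) \sum_(t <- msupp g) coef f s * coef g t * (s ++ t == u)%:R.
Proof.
rewrite /coef mcoeffMl; apply: eq_bigr => s _; apply: eq_bigr => t _.
by rewrite fmP fmM mulr_natr.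
Qed.

Lemma coef_expand f u : coef f u = \sum_(s <- msupp f) coef f s * (s == u)%:R.
Proof.
rewrite {1}[f]free_expand coef_sum; apply: eq_bigr => s _.
by rewrite coefZ coef_mono -fmP.
Qed.

Lemma coef1M f g :
  coef (f * g) (FMonom [::]) = coef f (FMonom [::]) * coef g (FMonom [::]).
Proof.
rewrite coefM (coef_expand f) (coef_expand g) mulr_suml.
apply: eq_bigr => u _; rewrite mulr_sumr; apply: eq_bigr => v _.
rewrite !fmP mulrACA -natrM mulnb; congr (_ * _%:R).
by case: u v => [[|? ?]] [[|? ?]].
Qed.

Lemma coef_varM f g i :
  coef (f * g) (FMonom [:: i]) =
    coef f (FMonom [::]) * coef g (FMonom [:: i]) +
    coef f (FMonom [:: i]) * coef g (FMonom [::]).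
Proof.
rewrite coefM (coef_expand f) (coef_expand g (FMonom [:: i])).
rewrite (coef_expand f (FMonom [:: i])) (coef_expand g (FMonom [::])).
rewrite !mulr_suml -big_split; apply: eq_bigr => u _.
rewrite !mulr_sumr -big_split; apply: eq_bigr => v _ /=.
rewrite !fmP [X in _ = X + _]mulrACA [X in _ = _ + X]mulrACA -mulrDr.
rewrite -!natrM -natrD; congr (_ * _%:R).
case: u v => [[|a [|? ?]]] [[|b [|? ?]]] /=;
  by rewrite ?cats0 ?muln0 ?mul0n ?muln1 ?mul1n ?addn0 ?eqseq_cons ?andbF.
Qed.

Definition homogeneous d (g : seq 'I_n -> k) : free_alg k n :=
  \sum_(w <- words n d) g w *: mono w.

Lemma coef_homogeneous d (g : seq 'I_n -> k) u :
  coef (homogeneous d g) u = if size u == d then g u else 0.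
Proof.
rewrite coef_sum.
under eq_bigr do rewrite coefZ coef_mono.
rewrite (bigID (pred1 (u : seq 'I_n))) /= [X in _ + X]big1; last first.
  by move=> s /negPf ->; rewrite mulr0.
rewrite addr0 -big_filter; case: eqP => [su|/eqP su].
  have -> : seq.filter (pred1 (u : seq 'I_n)) (words n d) = [:: (u : seq 'I_n)].
    by rewrite filter_pred1_uniq ?words_uniq ?mem_words ?su.
  by rewrite big_seq1 eqxx mulr1.
rewrite big_filter big1_seq // => s /andP[/eqP ->]; rewrite mem_words.
by rewrite (negPf su).
Qed.

Lemma deglex_leE u w : deglex_le u w =
  (size u < size w)%N || ((size u == size w) && (rank w <= rank u)%N).
Proof.
by rewrite /deglex_le; case: (size u =P size w) => // e; rewrite rank_lexi.
Qed.

Lemma deglex_max (s : seq (word n)) u : u \in s ->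
  exists2 w, w \in s & forall v, v \in s -> deglex_le v w.
Proof.
have refl (v : word n) : deglex_le v v by rewrite deglex_leE eqxx leqnn orbT.
have total (v w : word n) : deglex_le v w || deglex_le w v.
  by rewrite !deglex_leE; case: ltngtP => //= _; exact: leq_total.
have trans (v w t : word n) : deglex_le v w -> deglex_le w t -> deglex_le v t.
  rewrite !deglex_leE => /orP[a|/andP[/eqP -> a]] /orP[b|/andP[/eqP b c]].
  - by rewrite (ltn_trans a b).
  - by rewrite -b a.
  - by rewrite b.
  - by rewrite b eqxx (leq_trans c a) orbT.
elim: s u => // v s IH u _.
case: s IH => [|v' s] IH.
  by exists v; rewrite ?mem_head // => t; rewrite inE => /eqP ->.
have [w ws wmax] := IH v' (mem_head _ _).
have [vw|wv] := orP (total v w).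
- exists w; first by rewrite in_cons ws orbT.
  by move=> t; rewrite in_cons => /predU1P[->|/wmax].
- exists v; first exact: mem_head.
  by move=> t; rewrite in_cons => /predU1P[->|/wmax tw] //; exact: trans tw wv.
Qed.

Lemma leading_word_exists f u : coef f u != 0 -> exists w, leading_word f w.
Proof.
rewrite -mem_msupp => /deglex_max[w wf wmax].
by exists w; split.
Qed.

End FreeAlgebra.

(** * Algebras presented by a quadratic Groebner basis *)

Section PBW.
Variables (k : fieldType) (n : nat) (A : algType k) (x : 'I_n -> A).
Variables (rels : seq (free_alg k n)) (pi : {lrmorphism free_alg k n -> A}).
Hypothesis rels_quadratic : forall f, f \in rels -> quadratic_form f.
Hypothesis rels_groebner : groebner_basis rels.
Hypothesis pi_var : forall i, pi (free_var k i) = x i.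
Hypothesis pi_surj : forall a, exists f, pi f = a.
Hypothesis pi_ker : forall f, pi f = 0 <-> two_sided_ideal rels f.

Lemma pi_mono s : pi (mono k s) = monom x s.
Proof.
elim: s => [|i s IH]; first by rewrite mono0 rmorph1 /monom big_nil.
by rewrite -cat1s mono_cat rmorphM /= IH mono1 pi_var /monom big_cons.
Qed.

Lemma pi_homogeneous d g :
  pi (homogeneous d g) = \sum_(w <- words n d) g w *: monom x w.
Proof. by rewrite linear_sum; apply: eq_bigr => w _; rewrite linearZ /= pi_mono. Qed.

Lemma rels_pi f : f \in rels -> pi f = 0.
Proof.
move=> fr; apply/pi_ker; exists 1%N, (fun=> 1), (fun=> f), (fun=> 1).
by split=> //; rewrite big_ord1 mul1r mulr1.
Qed.

Lemma rels_leading f v : f \in rels -> leading_word f v ->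
  exists a b, v = [:: a; b] :> seq 'I_n /\ leading_pair x a b.
Proof.
move=> fr [vf vmax]; have sv := rels_quadratic fr vf.
have [a [b vE]] : exists a b, v = [:: a; b] :> seq 'I_n.
  by case: (v : seq _) sv => [|a [|b []]] // _; exists a, b.
exists a, b; split=> //; apply/asboolP.
pose g s := coef f (FMonom s).
have fE : homogeneous 2 g = f.
  apply/malgP => u; rewrite -/(coef _ u) coef_homogeneous -/(coef _ u).
  case: eqP => [_|su]; first by rewrite /g fmK.
  by apply/esym/eqP/negPn/negP => fu; apply: su; apply: rels_quadratic fr _ _;
    rewrite mem_msupp.
exists g.
  by rewrite /is_relation -pi_homogeneous fE rels_pi.
rewrite /leads -vE /g fmK -mem_msupp; split=> // z.
rewrite mem_words => /eqP sz; apply: contraTeq; rewrite -mem_msupp => /vmax.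
by rewrite deglex_leE /= sz sv eqxx /= -leqNgt.
Qed.

(** The Groebner property in terms of [leading_pair], which depends on the
    generators [x] but not on the presentation. *)
Lemma kernel_leading f w : pi f = 0 -> leading_word f w ->
  exists p q a b, w = p ++ [:: a; b] ++ q :> seq 'I_n /\ leading_pair x a b.
Proof.
move=> /pi_ker fI fw; have [r [v [rr rv /infixP[p [q wE]]]]] := rels_groebner fI fw.
have [a [b [vE ab]]] := rels_leading rr rv.
by exists p, q, a, b; rewrite -vE.
Qed.

Lemma pbw_groebner3 g z : is_relation x 3 g -> z \in words n 3 ->
  leads (words n 3) (@rank n) g z ->
  exists a b c, z = [:: a; b; c] /\ (leading_pair x a b || leading_pair x b c).
Proof.
move=> Rg; rewrite mem_words => sz [gz glow].
have pif : pi (homogeneous 3 g) = 0 by rewrite pi_homogeneous.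
have [|p [q [a [b [/= zE ab]]]]] := @kernel_leading _ (FMonom z) pif.
  split; first by rewrite mem_msupp coef_homogeneous sz.
  move=> u; rewrite mem_msupp coef_homogeneous.
  case: ifP => [/eqP su gu|_]; last by rewrite eqxx.
  rewrite deglex_leE /= su (eqP sz) ltnn eqxx /= leqNgt; apply: contra gu => lt.
  by rewrite glow // mem_words su.
move: sz; rewrite zE !size_cat /= !addnS !eqSS.
case: p {zE} => [|d [|? p]]; case: q => [|c [|? q]] // _.
- by exists a, b, c; rewrite ab.
- by exists d, a, b; rewrite ab orbT.
Qed.

(** A vanishing combination of normal words would come from an element of the
    ideal with a normal leading word. *)
Lemma normal_words_free (I : finType) (S : {set I}) (w : I -> seq 'I_n) :
  {in S &, injective w} ->
  (forall i, i \in S -> sorted (fun a b => ~~ leading_pair x a b) (w i)) ->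
  lin_indep (fun i => monom x (w i)) S.
Proof.
move=> w_inj w_normal c c0 i iS; apply/eqP/negPn/negP => ci.
pose f := \sum_(j in S) c j *: mono k (w j).
have pif : pi f = 0.
  by rewrite linear_sum -[RHS]c0; apply: eq_bigr => j _; rewrite linearZ /= pi_mono.
have fE j : j \in S -> coef f (FMonom (w j)) = c j.
  move=> jS; rewrite coef_sum (bigD1 j) //= coefZ coef_mono eqxx mulr1 big1 ?addr0 //.
  move=> l /andP[lS lj]; rewrite coefZ coef_mono /=.
  by case: eqP => [/(w_inj _ _ lS jS) e|]; rewrite ?mulr0 // e eqxx in lj *.
have [v fv] : exists v, leading_word f v.
  by apply: (@leading_word_exists _ _ f (FMonom (w i))); rewrite fE.
have [p [q [a [b [vE ab]]]]] := kernel_leading pif fv.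
have [j jS vj] : exists2 j, j \in S & v = w j :> seq _.
  case: fv => + _; rewrite mem_msupp coef_sum => nz.
  apply: contrapT => no; move/eqP: nz; apply; apply: big1 => j jS.
  rewrite coefZ coef_mono; case: eqP => [e|]; last by rewrite mulr0.
  by case: no; exists j.
have := w_normal j jS; rewrite -vj => vn.
by have := sorted_pair vn vE; rewrite ab.
Qed.

(** Makes the coefficients of degree at most one well defined on A. *)
Lemma ideal_coef_low f (u : word n) : pi f = 0 -> (size u < 2)%N -> coef f u = 0.
Proof.
move=> /pi_ker[N [a [r [b [rr ->]]]]] su; rewrite coef_sum big1 // => i _.
have r0 (v : word n) : (size v < 2)%N -> coef (r i) v = 0.
  move=> sv; apply/eqP/negPn/negP => nz.
  by move: sv; rewrite (rels_quadratic (rr i)) // mem_msupp.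
case: u su => [[|j [|? ?]]] // _.
  by rewrite !coef1M r0 // mulr0 mul0r.
by rewrite !(coef_varM, coef1M) !r0 // !(mulr0, mul0r, addr0).
Qed.

Definition preimage_of (a : A) : free_alg k n := projT1 (boolp.cid (pi_surj a)).

Lemma preimage_ofK a : pi (preimage_of a) = a.
Proof. by rewrite /preimage_of; case: boolp.cid. Qed.

Lemma coef_preimage_of f (u : word n) :
  (size u < 2)%N -> coef (preimage_of (pi f)) u = coef f u.
Proof.
move=> su; have := @ideal_coef_low (preimage_of (pi f) - f) u _ su.
rewrite linearB /= preimage_ofK subrr => /(_ erefl) /eqP.
by rewrite /coef mcoeffB subr_eq0 => /eqP.
Qed.

Lemma pi_ind2 (P : A -> A -> Prop) :
  (forall f g, P (pi f) (pi g)) -> forall a b, P a b.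
Proof. by move=> H a b; rewrite -(preimage_ofK a) -(preimage_ofK b). Qed.

Definition counit (a : A) : k := coef (preimage_of a) (FMonom [::]).
Definition linear_part (l : 'I_n) (a : A) : k := coef (preimage_of a) (FMonom [:: l]).

Lemma counit_pi f : counit (pi f) = coef f (FMonom [::]).
Proof. exact: coef_preimage_of. Qed.

Lemma linear_part_pi l f : linear_part l (pi f) = coef f (FMonom [:: l]).
Proof. exact: coef_preimage_of. Qed.

Lemma counitD : {morph counit : a b / a + b}.
Proof.
by apply: pi_ind2 => f g; rewrite -linearD /= !counit_pi coefD.
Qed.

Lemma counitM : {morph counit : a b / a * b}.
Proof.
by apply: pi_ind2 => f g; rewrite -rmorphM /= !counit_pi coef1M.
Qed.

Lemma counit_scal c : counit c%:A = c.
Proof.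
rewrite -(rmorph1 pi) -linearZ /= counit_pi coefZ -mono0 coef_mono eqxx.
by rewrite mulr1.
Qed.

Lemma counit1 : counit 1 = 1.
Proof. by rewrite -[1 in LHS]scale1r counit_scal. Qed.

Lemma counit_var i : counit (x i) = 0.
Proof. by rewrite -pi_var -mono1 counit_pi coef_mono. Qed.

Lemma linear_partD l : {morph linear_part l : a b / a + b}.
Proof.
by apply: pi_ind2 => f g; rewrite -linearD /= !linear_part_pi coefD.
Qed.

Lemma linear_partM l a b : linear_part l (a * b) =
  counit a * linear_part l b + linear_part l a * counit b.
Proof.
rewrite -(preimage_ofK a) -(preimage_ofK b) -rmorphM /= !linear_part_pi !counit_pi.
exact: coef_varM.
Qed.

Lemma linear_part_var l i : linear_part l (x i) = (l == i)%:R.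
Proof.
by rewrite -pi_var -mono1 linear_part_pi coef_mono /= eqseq_cons andbT eq_sym.
Qed.

Lemma scal_var c i : c%:A * x i = x i * c%:A.
Proof. by rewrite mulr_algl mulr_algr. Qed.

Definition pbw_marked : marked_ring k n A :=
  @MarkedRing k n A (fun c => c%:A) x counit linear_part
    (fun a b => scalerDl 1 a b) (fun a b => rmorphM (in_alg A) a b) scal_var
    counitD counitM counit1 counit_scal counit_var
    linear_partD linear_partM linear_part_var.

End PBW.

(** * The converse ring *)

Section Opposite.
Variables (k : fieldType) (n : nat) (B : pzRingType) (G : marked_ring k n B).

Fact opp_scalM : {morph (mk_scal G : k -> B^c) : a b / a * b}.
Proof. by move=> a b; rewrite mulrC mk_scalM. Qed.

Fact opp_scal_gen c i :
  (mk_scal G c : B^c) * mk_gen G i = (mk_gen G i : B^c) * mk_scal G c.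
Proof. exact: esym (mk_scal_gen G c i). Qed.

Fact opp_augM : {morph (mk_aug G : B^c -> k) : a b / a * b}.
Proof. by move=> a b; rewrite [RHS]mulrC -mk_augM. Qed.

Fact opp_derM l (a b : B^c) : mk_der G l (a * b) =
  mk_aug G a * mk_der G l b + mk_der G l a * mk_aug G b.
Proof. by rewrite [LHS]mk_derM addrC mulrC [X in _ + X]mulrC. Qed.

Definition opposite_marked : marked_ring k n B^c :=
  @MarkedRing k n B^c (mk_scal G) (mk_gen G) (mk_aug G) (mk_der G)
    (mk_scalD G) opp_scalM opp_scal_gen (mk_augD G) opp_augM (mk_aug1 G)
    (mk_aug_scal G) (mk_aug_gen G) (mk_derD G) opp_derM (mk_der_gen G).

(** Reversal exchanges the two tensor factors of each relation, as does passing
    to the converse ring. *)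
Lemma koszul_element_rev (N : seq 'I_n -> k) :
  (forall c d, mk_scal G c * d = d * mk_scal G c) ->
  koszul_element G N -> koszul_element opposite_marked (N \o rev).
Proof.
move=> central KN p q; rewrite exchange_big /= -[RHS](KN (rev q) (rev p)).
apply: eq_bigr => j _; apply: eq_bigr => i _.
have -> : rev (p ++ [:: i, j & q]) = rev q ++ [:: j; i] ++ rev p.
  by rewrite rev_cat -cat1s -[j :: q]cat1s !rev_cat -!catA.
exact: esym (central _ _).
Qed.

End Opposite.

(** * Long paths and global dimension *)

Section TwoSided.
Variables (k : fieldType) (n : nat) (A : algType k) (x : 'I_n -> A).

Lemma koszul_tensor_element (G : marked_ring k n A) (N : seq 'I_n -> k) :
  (forall c, mk_scal G c = c%:A) -> (forall i, mk_gen G i = x i) ->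
  koszul_tensor x N -> koszul_element G N.
Proof.
move=> Gs Gx KN p q; rewrite -[RHS](KN p q) (big_words_cat 1 1) big_words1.
apply: eq_bigr => i _; rewrite big_words1; apply: eq_bigr => j _.
by rewrite Gs !Gx mulr_algl /monom !big_cons big_nil mulr1.
Qed.

Theorem pbw_gldim_infinite : PBW_algebra x ->
  (forall d, exists2 w, size w = d & sorted (leading_pair x) w) ->
  gldim_infinite A.
Proof.
move=> [rels [pi [quad groeb pi_var pi_surj pi_ker]]] paths.
pose G := pbw_marked quad pi_var pi_surj pi_ker.
have element d : exists N w, [/\ koszul_element G N, size w = d & N w = 1].
  have [w sw w_path] := paths d.
  have [N [KN Nw]] :=
    koszul_tensor_path (pbw_groebner3 quad groeb pi_var pi_ker) w_path.
  by exists N, w; split=> //; apply: koszul_tensor_element.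
split=> d fin; have [N [w [KN sw Nw]]] := element d.+1.
  have := koszul_element_vanish (fin (trivial_module G)) KN sw.
  by rewrite Nw => /eqP; rewrite oner_eq0.
have central c a : mk_scal G c * a = a * mk_scal G c.
  by rewrite /= mulr_algl mulr_algr.
have := koszul_element_vanish (fin (trivial_module (opposite_marked G)))
  (koszul_element_rev central KN) (w := rev w).
by rewrite size_rev /= revK Nw => /(_ sw) /eqP; rewrite oner_eq0.
Qed.

End TwoSided.

(** * Growth in the absence of long paths *)

Section Growth.

(** The height of a vertex is the length of the longest path leaving it. *)
Lemma acyclic_height (T : eqType) (e : rel T) (D : nat) :
  (forall w, size w = D -> ~~ sorted e w) ->
  exists h : T -> nat, forall a b, e a b -> (h b < h a)%N.
Proof.
move=> no_path; pose P a m := `[< exists2 t, size t = m & path e a t >].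
have bound a m : P a m -> (m <= D)%N.
  move=> /asboolP[t <- pt]; rewrite leqNgt; apply/negP => lt.
  have := no_path (take D (a :: t)).
  rewrite size_takel => [|/=]; last exact: leqW (ltnW lt).
  by move=> /(_ erefl) /negP; apply; apply: take_sorted.
have /boolp.choice[h hP] : forall a, exists m, P a m /\ forall m', P a m' -> (m' <= m)%N.
  move=> a; have ex : exists m, P a m by exists 0%N; apply/asboolP; exists [::].
  by case: (ex_maxnP ex (bound a)) => m Pm mmax; exists m.
exists h => a b ab; have [/asboolP[t st pt] _] := hP b.
apply: (hP a).2; apply/asboolP; exists (b :: t); first by rewrite /= st.
by rewrite /= ab.
Qed.

Variables (k : fieldType) (n : nat) (A : algType k) (x : 'I_n -> A).

Section SortedWords.
Variable h : 'I_n -> nat.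

(** The analogue of the monomial with exponent vector [a]. *)
Definition sorted_word M (a : {ffun 'I_n -> 'I_M.+1}) : seq 'I_n :=
  sort (fun i j => (h i <= h j)%N) (flatten [seq nseq (a i) i | i <- enum 'I_n]).

Lemma count_sorted_word M (a : {ffun 'I_n -> 'I_M.+1}) i :
  count_mem i (sorted_word a) = a i.
Proof.
rewrite /sorted_word count_sort count_flatten -map_comp sumnE big_map big_enum.
rewrite (bigD1 i) //= count_nseq /= eqxx mul1n big1 ?addn0 // => j /negPf ji.
by rewrite count_nseq /= ji.
Qed.

Lemma sorted_word_inj M : injective (@sorted_word M).
Proof.
move=> a b E; apply/ffunP => i; apply/val_inj.
by rewrite /= -!count_sorted_word E.
Qed.

Lemma size_sorted_word M (a : {ffun 'I_n -> 'I_M.+1}) :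
  (size (sorted_word a) <= n * M)%N.
Proof.
rewrite size_sort size_flatten /shape -map_comp sumnE big_map big_enum.
rewrite -[X in (X * M)%N]card_ord -sum_nat_const; apply: leq_sum => i _.
by rewrite /= size_nseq -ltnS.
Qed.

Lemma sorted_word_sorted M (a : {ffun 'I_n -> 'I_M.+1}) :
  sorted (fun i j => (h i <= h j)%N) (sorted_word a).
Proof. by apply: sort_sorted => i j; exact: leq_total. Qed.

End SortedWords.

Lemma tagged_tuple_inj N :
  injective (fun i : {j : 'I_N.+1 & j.-tuple 'I_n} => tval (tagged i)).
Proof.
move=> [i s] [j t] /= st.
have ij : i = j by apply/val_inj; rewrite /= -(size_tuple s) st size_tuple.
by subst j; congr existT; exact: val_inj.
Qed.

Lemma tagged_tuple_exists N (w : seq 'I_n) : (size w <= N)%N ->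
  exists i : {j : 'I_N.+1 & j.-tuple 'I_n}, tval (tagged i) = w.
Proof.
rewrite -ltnS => lt.
by exists (existT (fun j : 'I_N.+1 => j.-tuple 'I_n) (Ordinal lt) (in_tuple w)).
Qed.

(** Words sorted by height contain no leading pair, because heights drop along
    leading pairs. *)
Lemma growth_bound (h : 'I_n -> nat) M N : PBW_algebra x ->
  (forall a b, leading_pair x a b -> (h b < h a)%N) -> (n * M <= N)%N ->
  (M.+1 ^ n <= growth x N)%N.
Proof.
move=> [rels [pi [quad groeb pi_var _ pi_ker]]] hP le.
have /boolp.choice[F FE] : forall a : {ffun 'I_n -> 'I_M.+1},
    exists i : {j : 'I_N.+1 & j.-tuple 'I_n}, tval (tagged i) = sorted_word h a.
  by move=> a; apply: tagged_tuple_exists; apply: leq_trans (size_sorted_word _ _) le.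
have F_inj : injective F.
  by move=> a b E; apply: (@sorted_word_inj h); rewrite -!FE E.
have -> : (M.+1 ^ n)%N = #|[set F a | a : {ffun 'I_n -> 'I_M.+1}]|.
  by rewrite card_imset // card_ffun !card_ord.
rewrite /growth /dim_span; apply: leq_bigmax_cond; apply/asboolP.
apply: (normal_words_free quad groeb pi_var pi_ker).
  by move=> i j _ _; exact: tagged_tuple_inj.
move=> _ /imsetP[a _ ->]; rewrite FE.
apply: sub_sorted (sorted_word_sorted h a) => i j; apply: contraL => /hP.
by rewrite -ltnNge.
Qed.

End Growth.

Section GKdimBound.
Variables (R : realType) (k : fieldType) (n : nat).
Variables (A : algType k) (x : 'I_n -> A).
Local Open Scope ereal_scope.

Lemma limn_esup_ge (u : nat -> \bar R) (c : \bar R) N0 :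
  (forall N, (N0 <= N)%N -> c <= u N) -> c <= limn_esup u.
Proof.
move=> cu; rewrite limn_esup_lim; apply: lime_ge; first exact: is_cvg_esups.
apply: nearW => m; apply: le_trans (cu (maxn N0 m) (leq_maxl _ _)) _.
by apply: ereal_sup_ubound; exists (maxn N0 m) => //=; exact: leq_maxr.
Qed.

(** With M the quotient of N by n, the growth at N is at least (N / n)^n, so its
    logarithm is at least n (ln N - ln n), which exceeds c ln N for N large. *)
Lemma GKdim_ge (c : R) : (0 < n)%N -> (c < n%:R)%R ->
  (forall M N, (n * M <= N)%N -> (M.+1 ^ n <= growth x N)%N) ->
  c%:E <= GKdim R A.
Proof.
move=> n0 cn gr.
apply: (@le_trans _ _ (limn_esup
  (fun N => (ln ((growth x N)%:R : R) / ln (N%:R : R))%:E))); last first.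
  by apply: ereal_sup_ubound; exists n, x.
(* ln N >= ln b is n (ln N - ln n) >= c ln N, solved for ln N *)
pose b : R := expR (n%:R * ln n%:R / (n%:R - c)).
apply: (@limn_esup_ge _ _ (maxn 2 (Num.trunc b).+1)) => N.
rewrite geq_max => /andP[N2 Nb]; rewrite lee_fin.
have N0 : (0 < N%:R :> R)%R by rewrite ltr0n; apply: leq_trans N2.
have nR0 : (0 < n%:R :> R)%R by rewrite ltr0n.
have lnN : (0 < ln (N%:R : R))%R by rewrite ln_gt0 // ltr1n.
have nc : (0 < n%:R - c)%R by rewrite subr_gt0.
rewrite ler_pdivlMr //.
have lnb : (n%:R * ln n%:R / (n%:R - c) <= ln (N%:R : R))%R.
  rewrite -[leLHS]expRK ler_ln ?posrE ?expR_gt0 //.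
  apply: le_trans (_ : ((Num.trunc b).+1%:R <= _)%R); last by rewrite ler_nat.
  by apply/ltW; rewrite truncnS_gt.
have growN : (n%:R * (ln (N%:R : R) - ln n%:R) <= ln ((growth x N)%:R : R))%R.
  rewrite -ln_div ?posrE // mulr_natl -lnXn ?divr_gt0 //.
  have g := gr (N %/ n)%N N; rewrite mulnC leq_trunc_div in g; have {}g := g isT.
  rewrite ler_ln ?posrE ?exprn_gt0 ?divr_gt0 //; last first.
    by rewrite ltr0n (leq_trans _ g) // expn_gt0.
  apply: (@le_trans _ _ ((N %/ n).+1 ^ n)%:R)%R; last by rewrite ler_nat.
  rewrite natrX lerXn2r ?nnegrE ?ler0n ?divr_ge0 // ?ler0n //.
  rewrite ler_pdivrMr // -natrM ler_nat mulnC; apply: ltnW.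
  by rewrite mulnC -ltn_divLR.
apply: le_trans growN; rewrite mulrBr lerBrDr -lerBrDl -mulrBl [leRHS]mulrC.
by rewrite -ler_pdivrMr.
Qed.

End GKdimBound.

(** * Infinite global dimension *)

Theorem theorem4p8 (R : realType) (k : fieldType) (n : nat) (A : algType k)
    (x : 'I_n -> A) (m : R) :
  (2 <= n)%N -> PBW_algebra x -> GKdim R A = m%:E -> m < n%:R ->
  gldim_infinite A.
Proof.
move=> n2 pbw gk mn; apply: (pbw_gldim_infinite pbw) => d.
apply: contrapT => no_path.
have [w sw|h hP] := @acyclic_height _ (leading_pair x) d.
  by apply/negP => w_path; apply: no_path; exists w.
have := @GKdim_ge R k n A x ((m + n%:R) / 2) (ltnW n2) _
  (fun M N => @growth_bound k n A x h M N pbw hP).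
rewrite midf_lt // => /(_ isT); rewrite gk lee_fin leNgt.
by rewrite midf_lt.
Qed.
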